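(* Let $K$ be a field, $S=K[x_0,\ldots,x_n]$ with $x_0<x_1<\cdots<x_n$, and let $J\subseteq S$ be a strongly stable monomial ideal. Then the ideals $\mathfrak A$ and $\mathfrak R'$ of $K[C]$ are equal.
   Context: A term is a monomial $x^\alpha=x_0^{\alpha_0}\cdots x_n^{\alpha_n}$; for a term $x^\beta\neq 1$, $\min(x^\beta)$ is the smallest variable dividing it. A monomial ideal $J$ is strongly stable if for every term $x^\alpha\in J$ and all $0\le i<j\le n$ with $\alpha_i>0$, the term $x_j x^\alpha/x_i$ belongs to $J$. $B_J$ is the minimal set of monomial generators of $J$, $\mathcal N(J)$ is the set of terms not in $J$, $\mathcal N(J)_d$ the set of those of degree $d$, and $J_m$ the degree-$m$ homogeneous part of $J$. For every $x^\alpha\in B_J$ let $F_\alpha:=x^\alpha-\sum_{x^\gamma\in\mathcal N(J)_{|\alpha|}}C_{\alpha\gamma}x^\gamma$, where the $C_{\alpha\gamma}$ are new variables; $C$ is the set of all these variables and $\mathcal G=\{F_\alpha : x^\alpha\in B_J\}$, with head terms $Ht(F_\alpha)=x^\alpha$. Definition of $\mathfrak A$: for each $m$, let $A_m$ be the matrix whose columns correspond to the terms of degree $m$ in $S$ and whose rows correspond to all the polynomials of degree $m$ (in the $x_i$) of the form $x^\delta F_\alpha$, the row containing the coefficients of these terms in that polynomial. $\mathfrak A$ is the ideal of $K[C]$ generated by the minors of order $\dim_K J_m+1$ of $A_m$, for all $m$. Definition of $\mathfrak R'$: to every term $x^\beta\in J$ associate a polynomial $g_\beta$ with head term $x^\beta$,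 by induction on degree: if $x^\beta\in B_J$, $g_\beta:=F_\beta$; otherwise, with $x_i=\min(x^\beta)$ and $x^\epsilon=x^\beta/x_i$ (which lies in $J$), $g_\beta:=x_ig_\epsilon$. Let $\mathcal V_m:=\{g_\beta : x^\beta\in J\text{ a term of degree }m\}$. For $h\in K[C][x_0,\ldots,x_n]$ homogeneous of degree $m$ in the $x_i$, its $\mathcal V_m$-reduction is the polynomial with all its $x$-terms in $\mathcal N(J)$ obtained from $h$ by finitely many steps each replacing the current polynomial $h'$ by $h'-a\,g_\beta$, where $x^\beta\in J$ is a term occurring in $h'$ with coefficient $0\neq a\in K[C]$ (this terminates with a unique result). The $S$-polynomial is $S(F_\alpha,F_{\alpha'})=x^\delta F_\alpha-x^{\delta'}F_{\alpha'}$, where $x^{\delta+\alpha}=x^{\delta'+\alpha'}=\mathrm{lcm}(x^\alpha,x^{\alpha'})$. $\mathfrak R'\subseteq K[C]$ is the ideal generated by the coefficients (with respect to the $x$-terms) of the $\mathcal V_m$-reductions of those $S$-polynomials $x^\delta F_\alpha-x^{\delta'}F_{\alpha'}$, $F_\alpha,F_{\alpha'}\in\mathcal G$, such that $x^\delta F_\alpha\in\mathcal V_m$, where $m=|\delta+\alpha|$. *)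

(* Defs.v *)
From HB Require Import structures.
From mathcomp Require Import all_boot all_order all_algebra.
(* [monalg] and [mpoly] both declare notations such as ['X_{1..n}] and
   [{mpoly R[n]}]; only the ones of [mpoly] are wanted. *)
From mathcomp Require Import -(notations) monalg.
From mathcomp Require Import mpoly.

Set Implicit Arguments.
Unset Strict Implicit.
Unset Printing Implicit Defensive.

Import GRing.Theory.

Local Open Scope ring_scope.

Definition ideal_gen (R : comNzRingType) (G : R -> Prop) (x : R) : Prop :=
  exists2 s : seq (R * R),
    (forall ag, ag \in s -> G ag.2) & x = \sum_(ag <- s) ag.1 * ag.2.

Section MonomialIdeals.
Context {K : fieldType} {n : nat}.
Implicit Types (J : {pred {mpoly K[n.+1]}}) (M : 'X_{1..n.+1} -> Prop).
Implicit Types (m a b d : 'X_{1..n.+1}).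

Definition gen_by_terms J M : Prop :=
  forall p, p \in J <-> ideal_gen (fun q => exists2 m, M m & q = 'X_[m]) p.

(* The unit ideal is allowed, unlike in MathComp's [idealr_closed]. *)
Definition monomial_ideal J : Prop := exists M, gen_by_terms J M.

Definition strongly_stable J : Prop :=
  forall m (i j : 'I_n.+1), (i < j)%N -> 'X_[m] \in J -> (0 < m i)%N ->
    'X_[(m - U_(i) + U_(j))%MM] \in J.

(* Terms of J with no proper divisor in J; [min_gens_gen] and
   [min_gens_least] show that this is the least generating set of terms. *)
Definition min_gens J : {pred 'X_{1..n.+1}} :=
  fun m => ('X_[m] \in J) &&
    [forall d : 'X_{1..n.+1 < mdeg m}, (d <= m)%MM ==> ('X_[d] \notin J)].

Definition homog_terms J (d : nat) : seq (dhomog n.+1 K d) :=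
  [seq indhomog d 'X_[val u] | u : 'X_{1..n.+1 < d.+1} <- enum predT
     & (mdeg u == d) && ('X_[val u] \in J)].

(* Spanned by the terms of J of degree d; see [mem_homog_part]. *)
Definition homog_part J (d : nat) : {vspace dhomog n.+1 K d} :=
  <<homog_terms J d>>%VS.

(* Index of the smallest variable dividing a term (junk value on 1). *)
Definition min_var b : 'I_n.+1 :=
  odflt ord0 [pick i : 'I_n.+1 |
    (0 < b i)%N && [forall j : 'I_n.+1, (0 < b j)%N ==> (i <= j)%N]].

End MonomialIdeals.

Section MarkedFamily.
Context {K : fieldType} {n : nat} (J : {pred {mpoly K[n.+1]}}).
Implicit Types (a b c d m : 'X_{1..n.+1}).

(* The indices (a, c) of the parameters C_{a c}. *)
Definition Cparam : Type :=
  {ac : 'X_{1..n.+1} * 'X_{1..n.+1} |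
    [&& ac.1 \in min_gens J, 'X_[ac.2] \notin J & mdeg ac.2 == mdeg ac.1]}.

(* [malg (cmonom I) K] is the polynomial ring over K in the variables I. *)
Definition KC : comNzRingType := malg (cmonom Cparam) K.

(* The variable C_{a c}; 0 if (a, c) is not the index of a parameter. *)
Definition Cvar a c : KC :=
  if insub (a, c) is Some u then mkmalgU (ucm (u : Cparam)) 1 else 0.

Definition Fpoly a : {mpoly KC[n.+1]} :=
  'X_[a] - \sum_(c : 'X_{1..n.+1 < (mdeg a).+1}
                  | (mdeg c == mdeg a) && ('X_[c] \notin J))
             Cvar a c *: 'X_[c].

(* Pairs (x^d, x^a) indexing the products x^d F_a of degree k. *)
Definition row_index (k : nat) : finType :=
  {da : 'X_{1..n.+1 < k.+1, k.+1} |
    (val da.2 \in min_gens J) && (mdeg da.1 + mdeg da.2 == k)%N}.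

Definition col_index (k : nat) : finType :=
  {c : 'X_{1..n.+1 < k.+1} | mdeg c == k}.

Definition Aentry (k : nat) (r : row_index k) (c : col_index k) : KC :=
  ('X_[(val r).1] * Fpoly (val r).2)@_(val c).

Definition Amx (k : nat) : 'M[KC]_(#|row_index k|, #|col_index k|) :=
  \matrix_(i, j) Aentry (enum_val i) (enum_val j).

Definition is_minor (r p q : nat) (A : 'M[KC]_(p, q)) (x : KC) : Prop :=
  exists (f : 'I_r -> 'I_p) (g : 'I_r -> 'I_q),
    [/\ {homo f : i j / (i < j)%N}, {homo g : i j / (i < j)%N}
      & x = \det (mxsub f g A)].

Definition frakA (x : KC) : Prop :=
  ideal_gen
    (fun y => exists k, is_minor (\dim (homog_part J k)).+1 (Amx k) y) x.

(* The first argument bounds the number of recursive calls: each of them lowers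
   the degree by one, so [mdeg b] is enough for [b]; see [gpolyE]. *)
Fixpoint gpoly_rec (k : nat) b : {mpoly KC[n.+1]} :=
  if b \in min_gens J then Fpoly b else
  if k is k'.+1 then 'X_(min_var b) * gpoly_rec k' (b - U_(min_var b))%MM
  else 0.

Definition gpoly b := gpoly_rec (mdeg b) b.

Definition inV (k : nat) (p : {mpoly KC[n.+1]}) : Prop :=
  exists b, [/\ 'X_[b] \in J, mdeg b = k & p = gpoly b].

Inductive Vreduces (k : nat) : {mpoly KC[n.+1]} -> {mpoly KC[n.+1]} -> Prop :=
| Vreduces_refl h : Vreduces k h h
| Vreduces_step h h' b :
    'X_[b] \in J -> mdeg b = k -> h@_b != 0 ->
    Vreduces k (h - h@_b *: gpoly b) h' -> Vreduces k h h'.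

Definition is_Vreduction (k : nat) (h r : {mpoly KC[n.+1]}) : Prop :=
  Vreduces k h r /\ {in msupp r, forall c, 'X_[c] \notin J}.

Definition cofactorF a a' : {mpoly KC[n.+1]} :=
  'X_[(mlcm a a' - a)%MM] * Fpoly a.

Definition Spoly a a' : {mpoly KC[n.+1]} := cofactorF a a' - cofactorF a' a.

Definition frakR' (x : KC) : Prop :=
  ideal_gen (fun y => exists a a' r c,
    [/\ a \in min_gens J, a' \in min_gens J,
        inV (mdeg (mlcm a a')) (cofactorF a a'),
        is_Vreduction (mdeg (mlcm a a')) (Spoly a a') r
      & y = r@_c]) x.

End MarkedFamily.

Arguments frakA {K n} J x.
Arguments frakR' {K n} J x.

Section Facts.
Context {K : fieldType} {n : nat}.
Implicit Types (J : {pred {mpoly K[n.+1]}}) (M : 'X_{1..n.+1} -> Prop).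

Lemma min_varP (b : 'X_{1..n.+1}) : b != 0%MM ->
  (0 < b (min_var b))%N /\ forall j, (0 < b j)%N -> (min_var b <= j)%N.
Proof.
rewrite /min_var; case: pickP => [i /andP[bi /forallP h] _|noi].
  by split=> // j bj; apply: (implyP (h j)).
case/eqP; apply/mnmP => i; rewrite mnmE; apply/eqP; apply: contraFT (noi i).
rewrite -lt0n => bi.
case: (arg_minnP (P := fun j : 'I_n.+1 => 0 < b j)%N (fun j => val j) bi) => j.
move=> bj jmin; have := noi j; rewrite bj /=; move/negbT/forallPn => [l].
by rewrite negb_imply => /andP[/jmin ->].
Qed.

Lemma gpolyE J (b : 'X_{1..n.+1}) : b != 0%MM ->
  gpoly J b = if b \in min_gens J then Fpoly J b
              else 'X_(min_var b) * gpoly J (b - U_(min_var b))%MM.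
Proof.
move=> b0; have [bi _] := min_varP b0.
have hU : (U_(min_var b) <= b)%MM by rewrite lep1mP -lt0n.
have dE : mdeg b = (mdeg (b - U_(min_var b))%MM).+1.
  by rewrite -{1}(submK hU) mdegD mdeg1 addn1.
by rewrite /gpoly dE.
Qed.

Lemma gen_by_termsP J M : gen_by_terms J M -> forall p,
  p \in J <-> {in msupp p, forall m, exists2 d, M d & (d <= m)%MM}.
Proof.
move=> JM p; split=> [/JM [s sM ->] m|h].
  elim: s sM => [|[a q] s IH] sM; first by rewrite big_nil msupp0.
  rewrite big_cons => /msuppD_le; rewrite mem_cat => /orP[|]; last first.
    by apply: IH => ag ags; apply: sM; rewrite inE ags orbT.
  have [d Md /= ->] := sM _ (mem_head _ _).
  rewrite (perm_mem (msuppMX _ _)) => /mapP[d' _ ->].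
  by exists d => //; rewrite lem_addr.
apply/JM; rewrite [p]mpolyE.
elim: (msupp p) h => [|m s IH] h; first by exists [::]; rewrite ?big_nil.
have [|t tM e] := IH; first by move=> m' hm'; apply: h; rewrite inE hm' orbT.
have [d Md dm] := h _ (mem_head _ _).
exists ((p@_m *: 'X_[(m - d)%MM], 'X_[d]) :: t).
  by move=> ag; rewrite inE => /predU1P[->|/tM //]; exists d.
by rewrite !big_cons -e /= -scalerAl -mpolyXD submK.
Qed.

Lemma gen_by_termsX J M : gen_by_terms J M ->
  forall m, 'X_[m] \in J <-> exists2 d, M d & (d <= m)%MM.
Proof.
move=> JM m; rewrite (gen_by_termsP JM); split=> [|h m'].
  by apply; rewrite msuppX inE.
by rewrite msuppX inE => /eqP ->.
Qed.

Lemma monomial_idealP J : monomial_ideal J -> forall p,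
  p \in J <-> {in msupp p, forall m, 'X_[m] \in J}.
Proof.
case=> M JM p; rewrite (gen_by_termsP JM).
by split=> h m /h /(gen_by_termsX JM).
Qed.

Lemma min_gens_below J m : 'X_[m] \in J ->
  exists2 d, d \in min_gens J & (d <= m)%MM.
Proof.
have [k] := ubnP (mdeg m); elim: k m => // k IH m lek mJ.
have [mB|] := boolP (m \in min_gens J); first by exists m; rewrite ?lepm_refl.
rewrite unfold_in mJ /= => /forallPn[d]; rewrite negb_imply negbK.
case/andP=> dm /(IH _ (leq_trans (bmdeg d) (ltnSE lek)))[e eB ed].
by exists e => //; apply: lepm_trans ed dm.
Qed.

Lemma min_gens_gen J : monomial_ideal J ->
  gen_by_terms J (fun m => m \in min_gens J).
Proof.
case=> M JM; have JX := gen_by_termsX JM.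
have Bup m d : d \in min_gens J -> (d <= m)%MM -> 'X_[m] \in J.
  case/andP=> /JX[e Me ed] _ dm; apply/JX.
  by exists e => //; apply: lepm_trans ed dm.
move=> p; split=> [|[s sB ->]].
  rewrite (monomial_idealP (ex_intro _ M JM)) => h.
  rewrite [p]mpolyE; elim: (msupp p) h => [|m s IH] h.
    by exists [::]; rewrite ?big_nil.
  have [|t tB e] := IH; first by move=> m' hm'; apply: h; rewrite inE hm' orbT.
  have [d dB dm] := min_gens_below (h _ (mem_head _ _)).
  exists ((p@_m *: 'X_[(m - d)%MM], 'X_[d]) :: t).
    by move=> ag; rewrite inE => /predU1P[->|/tB //]; exists d.
  by rewrite !big_cons -e /= -scalerAl -mpolyXD submK.
apply/(monomial_idealP (ex_intro _ M JM)) => m.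
elim: s sB => [|[a q] s IH] sB; first by rewrite big_nil msupp0.
rewrite big_cons => /msuppD_le; rewrite mem_cat => /orP[|]; last first.
  by apply: IH => ag ags; apply: sB; rewrite inE ags orbT.
have [d dB /= ->] := sB _ (mem_head _ _).
rewrite (perm_mem (msuppMX _ _)) => /mapP[d' _ ->].
by apply: Bup dB _; rewrite lem_addr.
Qed.

Lemma min_gens_least J M : gen_by_terms J M ->
  forall m, m \in min_gens J -> M m.
Proof.
move=> JM m /andP[/(gen_by_termsX JM)[d Md dm] /forallP mmin].
have dJ : 'X_[d] \in J by apply/(gen_by_termsX JM); exists d; rewrite ?lepm_refl.
have [<- //|ned] := eqVneq d m.
have ltd : (mdeg d < mdeg m)%N.
  rewrite -(submK dm) mdegD -[X in (X < _)%N]add0n ltn_add2r lt0n mdeg_eq0.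
  by apply: contraNneq ned => e; rewrite -{1}[d]add0m -e submK.
by have := mmin (BMultinom ltd); rewrite /= dm dJ.
Qed.

Lemma mem_homog_part J (d : nat) (p : dhomog n.+1 K d) : monomial_ideal J ->
  (p \in homog_part J d) = (val p \in J).
Proof.
move=> /monomial_idealP JP; apply/idP/idP => [ph | /JP pJ].
  rewrite (coord_span (X := in_tuple (homog_terms J d)) ph).
  apply/JP => m; apply: contraTT => mJ.
  rewrite mcoeff_msupp negbK linear_sum raddf_sum /= big1 // => i _.
  have /mapP[u + ->] := mem_nth 0 (ltn_ord i : (i < size (homog_terms J d))%N).
  rewrite mem_filter => /andP[/andP[ud uJ] _].
  rewrite mcoeffZ /indhomog insubdK ?dhomogX // mcoeffX.
  by case: eqP uJ mJ => [->->|]; rewrite ?mulr0.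
have -> : p = \sum_(m <- msupp (val p)) (val p)@_m *: indhomog d 'X_[m].
  apply: val_inj; rewrite linear_sum [LHS]mpolyE /= big_seq [RHS]big_seq.
  apply: eq_bigr => m mp; congr (_ *: _); rewrite /indhomog insubdK // dhomogX.
  by apply/eqP; apply: (dhomogP _ _ _ (dhomog_is_dhomog p)).
rewrite big_seq; apply: memv_suml => m mp; apply/memvZ/memv_span.
have md : mdeg m == d.
  by apply/eqP; apply: (dhomogP _ _ _ (dhomog_is_dhomog p)).
have ltd : (mdeg m < d.+1)%N by rewrite (eqP md).
apply/mapP; exists (BMultinom ltd) => //.
by rewrite mem_filter /= md pJ // mem_enum.
Qed.

End Facts.

(* Main.v *)
(* Every term x^b of J is uniquely x^d x^a with a minimal generator x^a and all
   variables of x^d at most those of x^a, and then g_b = x^d F_a. If x^b = x^e x^g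
   is any other factorization, then x^d is lexicographically smaller than x^e
   unless x^a divides x^g. Hence the terms of J in the tail of x^d F_a have a
   smaller cofactor, so that reductions exist and the block of A_k with rows V_k
   and columns J_k is invertible. Bordering this block with a row x^e F_a and a
   column outside J gives, up to a factor, a coefficient of the reduction of
   x^e F_a; for S-polynomials this is R' <= A. Conversely, subtracting multiples of
   S-polynomials shows, by induction on x^e, that all rows x^e F_a lie in the span
   of V_k modulo R', so all minors of order #V_k + 1 vanish modulo R'. *)

Require Import Defs.
From mathcomp Require Import all_boot all_order all_algebra.
From mathcomp Require Import fingroup perm mpoly.

Set Implicit Arguments.
Unset Strict Implicit.
Unset Printing Implicit Defensive.

Import GRing.Theory.

Local Open Scope ring_scope.

(** * Generated ideals, and determinants modulo an ideal *)

Section IdealGen.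
Context {R : comNzRingType}.
Implicit Types (G H : R -> Prop) (x y : R).

Lemma ideal_gen_mem G x : G x -> ideal_gen G x.
Proof.
move=> Gx; exists [:: (1, x)]; last by rewrite big_seq1 mul1r.
by move=> ag; rewrite inE => /eqP->.
Qed.

Lemma ideal_gen0 G : ideal_gen G 0.
Proof. by exists [::]; rewrite ?big_nil. Qed.

Lemma ideal_genD G x y : ideal_gen G x -> ideal_gen G y -> ideal_gen G (x + y).
Proof.
case=> s sG -> [t tG ->]; exists (s ++ t); last by rewrite big_cat.
by move=> ag; rewrite mem_cat => /orP[/sG|/tG].
Qed.

Lemma ideal_genM G a x : ideal_gen G x -> ideal_gen G (a * x).
Proof.
case=> s sG ->; exists [seq (a * ag.1, ag.2) | ag <- s].
  by move=> ag /mapP[u /sG ? ->].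
by rewrite big_map mulr_sumr; apply: eq_bigr => u _ /=; rewrite mulrA.
Qed.

Lemma ideal_gen_sum G (I : eqType) (s : seq I) (F : I -> R) :
  (forall i, i \in s -> ideal_gen G (F i)) ->
  ideal_gen G (\sum_(i <- s) F i).
Proof.
move=> sG; rewrite big_seq; apply: (big_ind (ideal_gen G)) => //.
- exact: ideal_gen0.
- exact: ideal_genD.
Qed.

Lemma ideal_gen_le G H : (forall x, G x -> ideal_gen H x) ->
  forall x, ideal_gen G x -> ideal_gen H x.
Proof.
by move=> GH _ [s sG ->]; apply: ideal_gen_sum => ag /sG /GH; apply: ideal_genM.
Qed.

(** Congruence modulo the ideal is preserved by products, and the Leibniz formula is a signed sum of
    products of entries. *)
Lemma det_ideal_gen G (m : nat) (A B : 'M[R]_m) :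
  (forall i j, ideal_gen G (A i j - B i j)) -> ideal_gen G (\det A - \det B).
Proof.
move=> AB; rewrite /determinant -sumrB; apply: ideal_gen_sum => s _.
rewrite -mulrBr; apply: ideal_genM.
apply: (big_ind2 (fun x y => ideal_gen G (x - y))) => // [|x x' y y' xx' yy'].
  by rewrite subrr; apply: ideal_gen0.
have -> : x * y - x' * y' = y * (x - x') + x' * (y - y').
  by rewrite !mulrBr addrA [y * x]mulrC [y * x']mulrC subrK.
by apply: ideal_genD; apply: ideal_genM.
Qed.

End IdealGen.

(** * Determinants: rank bound, sorting of rows and columns, bordering *)

Section Determinants.
Context {R : comNzRingType}.

(** Padding [P] with a zero column and [Q] with a zero row makes both factors square without
    changing the product, and a matrix with a zero column has determinant 0. *)
Lemma det_mulmx_low (s : nat) (P : 'M[R]_(s.+1, s)) (Q : 'M[R]_(s, s.+1)) :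
  \det (P *m Q) = 0.
Proof.
have -> : P *m Q = (row_mx (0 : 'M_(s.+1, 1)) P : 'M_(s.+1, 1 + s)) *m
                   (col_mx (0 : 'M_(1, s.+1)) Q : 'M_(1 + s, s.+1)).
  by rewrite mul_row_col mul0mx add0r.
rewrite det_mulmx (expand_det_col _ ord0) big1 ?mul0r // => i _.
suff -> : @row_mx _ _ 1 s 0 P i ord0 = 0 by rewrite mul0r.
have -> : ord0 = lshift s (ord0 : 'I_1) by apply: val_inj.
by rewrite row_mxEl mxE.
Qed.

(** The permutation sends [i] to its rank, the number of values of [f] below [f i]; composing [f]
    with its inverse lists the values in increasing order. *)
Lemma increasing_rearrangement (r p : nat) (f : 'I_r -> 'I_p) : injective f ->
  exists (s : {perm 'I_r}) (f' : 'I_r -> 'I_p),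
    {homo f' : i j / (i < j)%N} /\ f =1 f' \o s.
Proof.
move=> fI.
have rk_lt i : (#|[set j | f j < f i]| < r)%N.
  rewrite -[X in (_ < X)%N]card_ord -cardsT; apply: proper_card.
  by apply/properP; split; [apply/subsetT | exists i; rewrite ?inE ?ltnn].
pose rk i := Ordinal (rk_lt i).
have rk_mono i j : (f i < f j)%N -> (rk i < rk j)%N.
  move=> ij; apply: proper_card; apply/properP; split.
    by apply/subsetP => l; rewrite !inE => /ltn_trans; apply.
  by exists i; rewrite ?inE ?ltnn.
have rkI : injective rk.
  move=> i j ij; apply/fI/val_inj; case: (ltngtP (f i) (f j)) => // /rk_mono.
    by rewrite ij ltnn.
  by rewrite ij ltnn.
exists (perm rkI), (f \o (perm rkI)^-1)%g; split=> [i j|i] /=; last first.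
  by rewrite permK.
rewrite -{1}[i](permKV (perm rkI)) -{1}[j](permKV (perm rkI)) !(permE rkI).
set i' := (perm rkI)^-1%g i; set j' := (perm rkI)^-1%g j => ij.
have ij' : i' != j' by apply: contraTneq ij => ->; rewrite ltnn.
rewrite ltn_neqAle (inj_eq (@ord_inj _)) (inj_eq fI) ij' leqNgt /=.
by apply: contraTN ij => /rk_mono; rewrite -leqNgt => /ltnW.
Qed.

Lemma det_mxsub_eq0 (r p q : nat) (A : 'M[R]_(p, q)) (f : 'I_r -> 'I_p) g :
  ~ injective f -> \det (mxsub f g A) = 0.
Proof.
move/injectiveP/injectivePn=> [i [j ij eqf]]; apply: (determinant_alternate ij) => k.
by rewrite !mxE eqf.
Qed.

Lemma det_mxsub_increasing (r p q : nat) (A : 'M[R]_(p, q)) (f : 'I_r -> 'I_p)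
    g : injective f -> exists (b : bool) (f' : 'I_r -> 'I_p),
  {homo f' : i j / (i < j)%N} /\
  \det (mxsub f g A) = (-1) ^+ b * \det (mxsub f' g A).
Proof.
move=> /increasing_rearrangement[s [f' [f'i ff']]]; exists s, f'; split=> //.
rewrite -det_perm -det_mulmx -row_permE; congr (\det _).
by apply/matrixP => i j; rewrite !mxE ff'.
Qed.

(** Multiplying on the left by the block matrix with rows [(-1, y)] and [(0, P)] clears [u] and
    leaves a lower triangular matrix with diagonal blocks [z] and 1. *)
Lemma bordered_det (s : nat) (a z : R) (u y : 'rV[R]_s) (v : 'cV[R]_s)
    (T P : 'M[R]_s) :
    P *m T = 1%:M -> y *m T = u -> (y *m v) 0 0 = a + z ->
  exists w, z = w * \det (block_mx a%:M u v T : 'M_(1 + s)).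
Proof.
move=> PT yT yv; exists (\det (block_mx (-1)%:M y 0 P : 'M_(1 + s))).
rewrite -det_mulmx mulmx_block PT yT !mul_scalar_mx !scaleN1r addNr !mul0mx !add0r.
by rewrite det_lblock det1 mulr1 det_mx11 2!mxE yv mxE addKr.
Qed.

Definition ord_border (s p : nat) (i0 : 'I_p) (f : 'I_s -> 'I_p)
    (i : 'I_(1 + s)) : 'I_p :=
  if split i is inr l then f l else i0.

Lemma mxsub_border (s p q : nat) (A : 'M[R]_(p, q)) i0 j0
    (f : 'I_s -> 'I_p) (g : 'I_s -> 'I_q) :
  mxsub (ord_border i0 f) (ord_border j0 g) A =
  block_mx (A i0 j0)%:M (\row_l A i0 (g l))
    (\col_l A (f l) j0) (mxsub f g A).
Proof.
apply/matrixP => i j; rewrite !mxE /ord_border.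
by case: (split i) => i'; rewrite !mxE; case: (split j) => j'; rewrite !mxE ?ord1.
Qed.

End Determinants.

(** A repeated row or column gives determinant 0. Otherwise sorting the rows, and the columns by
    transposition, only changes the sign. This frees later choices of rows and columns from any
    order. *)
Lemma det_mxsub_minors (K : fieldType) (n : nat) (J : {pred {mpoly K[n.+1]}})
    (r p q : nat) (A : 'M[KC J]_(p, q)) (f : 'I_r -> 'I_p) (g : 'I_r -> 'I_q) :
  ideal_gen (is_minor r A) (\det (mxsub f g A)).
Proof.
have [fI|/det_mxsub_eq0->] := injectiveP f; last exact: ideal_gen0.
have [b [f' [f'i ->]]] := det_mxsub_increasing A g fI; apply: ideal_genM.
have [gI|] := injectiveP g; last first.
  by move=> ng; rewrite -det_tr trmx_mxsub det_mxsub_eq0 //; exact: ideal_gen0.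
have [c [g' [g'i e]]] := det_mxsub_increasing A^T f' gI.
rewrite -det_tr trmx_mxsub e -trmx_mxsub det_tr; apply: ideal_genM.
by apply: ideal_gen_mem; exists f', g'.
Qed.

(** * Lexicographic comparison of cofactors by a numerical weight *)

Section Weight.
Context {n : nat}.
Implicit Types (d e a g : 'X_{1..n.+1}).

(* When all exponents are below B, comparing the numbers with these base B digits
   is the lexicographic comparison with the last variable most significant. *)
Definition lex_weight (B : nat) d : nat :=
  (\sum_(i < n.+1) d i * B ^ i)%N.

Lemma lex_weightD B d e :
  lex_weight B (d + e)%MM = (lex_weight B d + lex_weight B e)%N.
Proof.
by rewrite -big_split; apply: eq_bigr => i _; rewrite mnmDE mulnDl.
Qed.

(** The top digit decides first: as the digits of [u] are below [B], its part below position [N] is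
    less than [B ^ N], so a smaller digit of [u] at [N] makes the whole sum smaller. The digits of
    [v] may exceed [B], so the third case asserts no inequality of sums. *)
Lemma digits_cmp (B : nat) (u v : nat -> nat) (N : nat) :
    (forall i, u i < B)%N ->
  [\/ forall i, (i < N)%N -> u i = v i,
      (\sum_(i < N) u i * B ^ i < \sum_(i < N) v i * B ^ i)%N
    | exists j, [/\ (j < N)%N, (v j < u j)%N
                  & forall l, (j < l < N)%N -> u l = v l]].
Proof.
move=> uB; have W N' : (\sum_(i < N') u i * B ^ i < B ^ N')%N.
  elim: N' => [|N' IH]; first by rewrite big_ord0 expn0.
  rewrite big_ord_recr /= expnS.
  apply: (@leq_trans (B ^ N' + u N' * B ^ N')%N); first by rewrite ltn_add2r.
  by rewrite -mulSn leq_mul2r uB orbT.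
elim: N => [|N IH]; first by constructor 1.
rewrite !big_ord_recr /=; case: (ltngtP (u N) (v N)) => uv.
- constructor 2; apply: leq_trans (leq_addl _ _).
  apply: (@leq_trans (B ^ N + u N * B ^ N)%N); first by rewrite ltn_add2r W.
  by rewrite -mulSn leq_mul2r uv orbT.
- constructor 3; exists N; split=> // l /andP[Nl]; rewrite ltnS => lN.
  by have := leq_trans Nl lN; rewrite ltnn.
- case: IH => [eq|lt|[j [jN vu eq]]].
  + constructor 1 => i; rewrite ltnS leq_eqVlt => /predU1P[->|/eq] //.
  + by constructor 2; rewrite uv ltn_add2r.
  + constructor 3; exists j; split=> // [|l /andP[jl]]; first exact: leqW.
    rewrite ltnS leq_eqVlt => /predU1P[->|lN] //.
    by apply: eq; rewrite jl.
Qed.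

Lemma lex_weight_cmp B d e : (mdeg d < B)%N ->
  [\/ d = e, (lex_weight B d < lex_weight B e)%N
    | exists2 j, (e j < d j)%N & forall l : 'I_n.+1, (j < l)%N -> d l = e l].
Proof.
move=> dB; have dB' i : (d (inord i) < B)%N.
  by apply: leq_ltn_trans dB; rewrite mdegE (bigD1 (inord i)) ?leq_addr.
have wE f : lex_weight B f = (\sum_(i < n.+1) f (inord i) * B ^ i)%N.
  by apply: eq_bigr => i _; rewrite inord_val.
case: (digits_cmp (fun i => e (inord i)) n.+1 dB') => [eq|lt|[j [jn ed eq]]].
- constructor 1; apply/mnmP => i.
  by have := eq i (ltn_ord i); rewrite inord_val.
- by constructor 2; rewrite !wE.
- constructor 3; exists (inord j) => // l; rewrite inordK // => jl.
  by have := eq l; rewrite jl ltn_ord inord_val; apply.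
Qed.

Definition separated d a : Prop :=
  forall i j : 'I_n.+1, (0 < d i)%N -> (0 < a j)%N -> (i <= j)%N.

(* If d > e lexicographically and j is the last index where they differ, a has no
   variable before x_j, and a <= g holds from x_j on. *)
Lemma separated_lex B d e a g : (mdeg d < B)%N -> separated d a ->
  (d + a = e + g)%MM -> (lex_weight B d < lex_weight B e)%N \/ (a <= g)%MM.
Proof.
move=> dB sep E; case: (lex_weight_cmp e dB) => [de||[j ed eq]]; last 1 first.
- right; apply/mnm_lepP => l; have := congr1 (fun m : 'X_{1..n.+1} => m l) E.
  rewrite !mnmDE; case: (ltngtP l j) => [lj|jl|/ord_inj->].
  + case: (posnP (a l)) => [->//|al].
    have := sep j l (leq_ltn_trans (leq0n _) ed) al.
    by rewrite leqNgt lj.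
  + by rewrite eq // => /addnI->.
  + by move=> E'; rewrite -(leq_add2l (d j)) E' leq_add2r ltnW.
- by right; move: E; rewrite de => /addmI->; apply: lepm_refl.
- by left.
Qed.

End Weight.

(** * Coefficients of the rows, and the distinguished factorization of terms of J *)

Section Terms.
Context {K : fieldType} {n : nat} {J : {pred {mpoly K[n.+1]}}}.
Implicit Types (a b c d e g m : 'X_{1..n.+1}).

Lemma min_gens_antichain a b :
  a \in min_gens J -> b \in min_gens J -> (a <= b)%MM -> a = b.
Proof.
move=> /andP[aJ _] /andP[_ /forallP bmin] ab; apply: contraTeq aJ => neq.
have lt : (mdeg a < mdeg b)%N.
  rewrite -(submK ab) mdegD -[X in (X < _)%N]add0n ltn_add2r lt0n mdeg_eq0.
  by apply: contraNneq neq => e; rewrite -[b](submK ab) e add0m.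
by have := bmin (BMultinom lt); rewrite ab.
Qed.

Lemma min_gens_in a : a \in min_gens J -> 'X_[a] \in J.
Proof. by case/andP. Qed.

Section Coefficients.
Implicit Types p : {mpoly (KC J)[n.+1]}.

Lemma mcoeffXM d p c :
  ('X_[d] * p)@_c = if (d <= c)%MM then p@_(c - d)%MM else 0.
Proof.
rewrite -commr_mpolyX; case: ifP => [dc|dc].
  by rewrite -{1}(submK dc) addmC mcoeffMX.
apply: memN_msupp_eq0; apply: contraFN dc.
by rewrite (perm_mem (msuppMX _ _)) => /mapP[e _ ->]; apply: lem_addr.
Qed.

Lemma mcoeff_Fpoly_head a : 'X_[a] \in J -> (Fpoly J a)@_a = 1.
Proof.
move=> aJ; rewrite /Fpoly mcoeffB mcoeffX eqxx raddf_sum big1 ?subr0 //= => u.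
case/andP=> _ uJ; rewrite mcoeffZ mcoeffX; case: eqP => [e|]; rewrite ?mulr0 //.
by rewrite e aJ in uJ.
Qed.

Lemma mcoeff_Fpoly_tail a c : (Fpoly J a)@_c != 0 -> c != a ->
  mdeg c = mdeg a /\ 'X_[c] \notin J.
Proof.
move=> + /negbTE ca; rewrite /Fpoly mcoeffB mcoeffX [a == c]eq_sym ca sub0r.
have [/andP[/eqP-> ->] //|cJ] := boolP ((mdeg c == mdeg a) && ('X_[c] \notin J)).
rewrite raddf_sum big1 ?oppr0 ?eqxx //= => u uJ.
rewrite mcoeffZ mcoeffX; case: eqP => [e|]; rewrite ?mulr0 //.
by rewrite -e uJ in cJ.
Qed.

Lemma mcoeff_row_head d a : 'X_[a] \in J -> ('X_[d] * Fpoly J a)@_(d + a) = 1.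
Proof.
by move=> aJ; rewrite mcoeffXM lem_addr addmC addmK mcoeff_Fpoly_head.
Qed.

Lemma mcoeff_row_tail d a c : ('X_[d] * Fpoly J a)@_c != 0 -> c != (d + a)%MM ->
  exists g, [/\ c = (d + g)%MM, mdeg g = mdeg a & 'X_[g] \notin J].
Proof.
rewrite mcoeffXM; case: ifP => [dc|]; rewrite ?eqxx // => Fc neq.
have [|mg gJ] := mcoeff_Fpoly_tail Fc.
  by apply: contraNneq neq => <-; rewrite addmC submK.
by exists (c - d)%MM; rewrite addmC submK.
Qed.

Lemma mdeg_row d a c : ('X_[d] * Fpoly J a)@_c != 0 -> mdeg c = mdeg (d + a)%MM.
Proof.
have [->//|cda] := eqVneq c (d + a)%MM.
by case/mcoeff_row_tail=> // g [-> mg _]; rewrite !mdegD mg.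
Qed.

End Coefficients.

(* The generator x^a in the decomposition x^b = x^d x^a with g_b = x^d F_a. *)
Fixpoint star_head_rec (k : nat) b : 'X_{1..n.+1} :=
  if b \in min_gens J then b else
  if k is k'.+1 then star_head_rec k' (b - U_(min_var b))%MM else b.

Definition star_head b := star_head_rec (mdeg b) b.

Lemma mdeg_sub_min_var b : b != 0%MM ->
  mdeg b = (mdeg (b - U_(min_var b))%MM).+1.
Proof.
move=> /min_varP[bi _]; have hU : (U_(min_var b) <= b)%MM by rewrite lep1mP -lt0n.
by rewrite -{1}(submK hU) mdegD mdeg1 addn1.
Qed.

Lemma star_headE b : b != 0%MM ->
  star_head b = if b \in min_gens J then b
                else star_head (b - U_(min_var b))%MM.
Proof. by move=> b0; rewrite /star_head (mdeg_sub_min_var b0). Qed.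

Hypotheses (J_monomial : monomial_ideal J) (J_stable : strongly_stable J).

Lemma monomial_ideal_up a b : 'X_[a] \in J -> (a <= b)%MM -> 'X_[b] \in J.
Proof.
case: J_monomial => M JM /(gen_by_termsX JM)[d Md da] ab.
by apply/(gen_by_termsX JM); exists d => //; apply: lepm_trans ab.
Qed.

(** A generator properly divides [b], so [b / x_i] is in J for some [i]. If [x_i] is not the
    smallest variable [x_l] of [b], strong stability replaces [x_l] by the larger [x_i] in
    [b / x_i], which gives [b / x_l]. *)
Lemma sub_min_var_in b : 'X_[b] \in J -> b \notin min_gens J ->
  b != 0%MM /\ 'X_[(b - U_(min_var b))%MM] \in J.
Proof.
move=> bJ bB; have [d dB db] := min_gens_below bJ.
have [i dbi] : exists i, (d i < b i)%N.
  apply/existsP; apply: contraNT bB => /existsPn h.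
  suff -> : b = d by [].
  apply/mnmP => i; apply/eqP; rewrite eqn_leq leqNgt (h i) /=.
  exact: (mnm_lepP db).
have bi : (0 < b i)%N by apply: leq_ltn_trans dbi.
have b0 : b != 0%MM.
  by apply: contraTneq bi => ->; rewrite mnm0E.
split=> //; have [bm mmin] := min_varP b0; set l := min_var b in bm mmin *.
have biJ : 'X_[(b - U_(i))%MM] \in J.
  apply: monomial_ideal_up (min_gens_in dB) _.
  apply/mnm_lepP => j; rewrite mnmBE mnm1E; case: eqP => [<-|_].
    by rewrite subn1 -ltnS prednK.
  by rewrite subn0; apply: (mnm_lepP db).
have := mmin i bi; rewrite leq_eqVlt => /predU1P[/ord_inj->//|li].
have neq : (i == l) = false by apply: contraTF li => /eqP->; rewrite ltnn.
have := J_stable li biJ; rewrite mnmBE mnm1E neq subn0 bm => /(_ isT).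
congr (_ \in J); congr 'X_[_]; apply/mnmP => j.
rewrite mnmDE !mnmBE !mnm1E; case: (eqVneq i j) => [<-|_]; last first.
  by rewrite subn0 addn0.
by rewrite [l == i]eq_sym neq !subn0 subn1 addn1 prednK.
Qed.

(** Induction along the recursion of [gpoly]. Each variable removed is the smallest of the current
    term, which the head divides, so it is at most every variable of the head. *)
Lemma star_headP b : 'X_[b] \in J ->
  [/\ star_head b \in min_gens J, (star_head b <= b)%MM,
      separated (b - star_head b)%MM (star_head b)
    & gpoly J b = 'X_[(b - star_head b)%MM] * Fpoly J (star_head b)].
Proof.
have [k] := ubnP (mdeg b); elim: k b => // k IH b bk bJ.
have [bB|bB] := boolP (b \in min_gens J).
  have -> : star_head b = b by rewrite /star_head; case: (mdeg b) => /= *; rewrite bB.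
  have -> : gpoly J b = Fpoly J b by rewrite /gpoly; case: (mdeg b) => /= *; rewrite bB.
  have -> : (b - b)%MM = 0%MM by apply/mnmP => i; rewrite mnmBE mnm0E subnn.
  rewrite lepm_refl mpolyX0 mul1r; split; [exact: bB | by [] | | by []].
  by move=> i j; rewrite mnm0E.
have [b0 b'J] := sub_min_var_in bJ bB; have [bi mmin] := min_varP b0.
rewrite star_headE // gpolyE // (negbTE bB); set i := min_var b in bi mmin b'J *.
have ib : (U_(i) <= b)%MM by rewrite lep1mP -lt0n.
have [|hB hb sep ->] := IH (b - U_(i))%MM _ b'J.
  by rewrite -ltnS -mdeg_sub_min_var.
set h := star_head _ in hB hb sep *.
have b'b : (b - U_(i) <= b)%MM by apply/mnm_lepP => j; rewrite mnmBE leq_subr.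
have E : (b - h = U_(i) + (b - U_(i) - h))%MM.
  apply/mnmP => j; have := mnm_lepP hb j; have := mnm_lepP ib j.
  rewrite !(mnmDE, mnmBE) => ij hj.
  rewrite -!subnDA [X in (_ + (_ - X))%N]addnC subnDA addnC subnK //.
  by rewrite leq_subRL ?(leq_trans hj) ?leq_subr // addnC -leq_subRL.
split.
- exact: hB.
- exact: lepm_trans hb b'b.
- move=> j l; rewrite E mnmDE mnm1E; case: eqP => [<- _ hl|_]; last exact: sep.
  by apply: mmin; apply: leq_trans hl (mnm_lepP (lepm_trans hb b'b) l).
- by rewrite E mpolyXD -mulrA.
Qed.

Definition star_weight B b := lex_weight B (b - star_head b)%MM.

Lemma mdeg_star b : (mdeg (b - star_head b)%MM <= mdeg b)%N.
Proof.
by rewrite !mdegE; apply: leq_sum => i _; rewrite mnmBE leq_subr.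
Qed.

(** The other alternative of [separated_lex], that the star head divides [g], would put [g] in J. *)
Lemma star_weight_out B d g : (mdeg (d + g)%MM < B)%N ->
    'X_[(d + g)%MM] \in J -> 'X_[g] \notin J ->
  (star_weight B (d + g)%MM < lex_weight B d)%N.
Proof.
move=> mB cJ gJ; have [hB hc sep _] := star_headP cJ.
have [] := @separated_lex _ B _ d _ g (leq_ltn_trans (mdeg_star _) mB) sep.
- by rewrite submK.
- by [].
- by move=> /(monomial_ideal_up (min_gens_in hB)); rewrite (negbTE gJ).
Qed.

Lemma star_weight_gen B d a : (mdeg (d + a)%MM < B)%N -> a \in min_gens J ->
  a != star_head (d + a)%MM -> (star_weight B (d + a)%MM < lex_weight B d)%N.
Proof.
move=> mB aB neq.
have cJ := monomial_ideal_up (min_gens_in aB) (lem_addl d a).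
have [hB hc sep _] := star_headP cJ.
have [] := @separated_lex _ B _ d _ a (leq_ltn_trans (mdeg_star _) mB) sep.
- by rewrite submK.
- by [].
- by move=> /(min_gens_antichain hB aB) E; rewrite E eqxx in neq.
Qed.

(** Uniqueness of the factorization: with two distinct separated ones, each cofactor would have
    smaller weight than the other. *)
Lemma star_head_separated d a : a \in min_gens J -> separated d a ->
  star_head (d + a)%MM = a.
Proof.
move=> aB sep; apply/eqP; rewrite eq_sym; apply/negP => /negP neq.
have lt := star_weight_gen (ltnSn _) aB neq.
have cJ := monomial_ideal_up (min_gens_in aB) (lem_addl d a).
have [hB hc _ _] := star_headP cJ.
have [] := @separated_lex _ (mdeg (d + a)%MM).+1 d (d + a - star_head (d + a))%MM _
  (star_head (d + a)%MM) _ sep.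
- by rewrite ltnS mdegD leq_addr.
- by rewrite submK.
- by move=> /(ltn_trans lt); rewrite ltnn.
- by move=> /(min_gens_antichain aB hB) E; rewrite -E eqxx in neq.
Qed.

Lemma mcoeff_gpoly_head b : 'X_[b] \in J -> (gpoly J b)@_b = 1.
Proof.
case/star_headP=> hB hb _ ->.
by have := mcoeff_row_head (b - star_head b)%MM (min_gens_in hB); rewrite submK.
Qed.

(** This is what makes reduction terminate: a step at [b] creates only terms of J of smaller star
    weight. *)
Lemma mcoeff_gpoly_tail B b c : (mdeg b < B)%N -> 'X_[b] \in J ->
    (gpoly J b)@_c != 0 -> c != b ->
  mdeg c = mdeg b /\ ('X_[c] \in J -> star_weight B c < star_weight B b)%N.
Proof.
move=> bB /star_headP[hB hb sep ->] bc neq.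
have [|g [E mg gJ]] := mcoeff_row_tail bc; first by rewrite submK.
have mE : mdeg c = mdeg b by rewrite E mdegD mg -mdegD submK.
by split=> //; move: bB; rewrite -mE E => cB cJ; apply: star_weight_out.
Qed.

End Terms.

Arguments star_head {K n} J b.
Arguments star_weight {K n} J B b.

Lemma mul_sub_cancel (R : pzRingType) (u v w s t : R) :
  u * w * t = u * v * s - u * (v * s - w * t).
Proof. by rewrite mulrBr !mulrA opprB addrCA subrr addr0. Qed.

Lemma sub_eq_solve (V : zmodType) (u v s r : V) :
  u - v = s + r -> v = - s + u - r.
Proof. by move=> E; rewrite addrAC -opprD -E opprB subrK. Qed.

(** * Existence of reductions, and the span of the rows modulo R' *)

Section Reduction.
Context {K : fieldType} {n : nat} {J : {pred {mpoly K[n.+1]}}}.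
Implicit Types (a b c d e g m : 'X_{1..n.+1}) (p h r : {mpoly (KC J)[n.+1]}).

Definition terms (k : nat) : seq 'X_{1..n.+1} :=
  [seq val u | u : 'X_{1..n.+1 < k.+1} <- enum predT
     & (mdeg u == k) && ('X_[val u] \in J)].

Lemma mem_terms k b : (b \in terms k) = (mdeg b == k) && ('X_[b] \in J).
Proof.
apply/mapP/andP => [[u + ->]|[bk bJ]]; first by rewrite mem_filter => /andP[/andP[]].
have lt : (mdeg b < k.+1)%N by rewrite (eqP bk).
by exists (BMultinom lt); rewrite // mem_filter /= bk bJ mem_enum.
Qed.

Lemma terms_uniq k : uniq (terms k).
Proof.
rewrite map_inj_uniq; last exact: val_inj.
by rewrite filter_uniq // enum_uniq.
Qed.

Lemma dim_homog_part k : \dim (homog_part J k) = size (terms k).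
Proof.
rewrite /homog_part; set s := homog_terms J k.
have sE : s = [seq indhomog k 'X_[b] | b <- terms k].
  by rewrite /s /homog_terms /terms -map_comp.
suff /eqP -> : free s by rewrite sE size_map.
rewrite sE; apply/(@freeP _ _ _ (in_tuple _)) => x x0 i.
have lt (j : 'I_(size [seq indhomog k ('X_[b] : {mpoly K[n.+1]}) | b <- terms k])) :
  (j < size (terms k))%N by have := ltn_ord j; rewrite [X in (_ < X)%N]size_map.
(* The terms are distinct, so the coefficient of the vanishing combination at the [i]-th term is
   [x i]. *)
have /(congr1 (fun p : dhomog n.+1 K k => (val p)@_(nth 0%MM (terms k) i))) := x0.
have nthP (j : nat) : (j < size (terms k))%N ->
    val (nth 0 [seq indhomog k ('X_[b] : {mpoly K[n.+1]}) | b <- terms k] j) =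
    'X_[nth 0%MM (terms k) j].
  move=> jb; rewrite (nth_map 0%MM) // /indhomog insubdK // dhomogX.
  by have := mem_nth 0%MM jb; rewrite mem_terms => /andP[].
rewrite linear_sum raddf_sum /= (bigD1 i) //= mcoeffZ nthP // mcoeffX eqxx mulr1.
rewrite big1 ?addr0 ?mcoeff0 // => j ji; rewrite mcoeffZ nthP //.
rewrite mcoeffX nth_uniq ?terms_uniq //.
by rewrite (inj_eq (@ord_inj _)) (negbTE ji) mulr0.
Qed.

Lemma sum_terms_single k b (x : KC J) : b \in terms k ->
  \sum_(c <- terms k) (if c == b then x else 0) *: gpoly J c = x *: gpoly J b.
Proof.
move=> bk; rewrite (bigD1_seq b) ?terms_uniq //= eqxx big1 ?addr0 // => c.
by move/negbTE=> ->; rewrite scale0r.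
Qed.

Lemma sum_terms_update k b (z : KC J) (x : 'X_{1..n.+1} -> KC J) :
    b \in terms k ->
  \sum_(c <- terms k) (x c + if c == b then z else 0) *: gpoly J c =
  \sum_(c <- terms k) x c *: gpoly J c + z *: gpoly J b.
Proof.
move=> bk; apply: etrans (eq_bigr _ (fun c _ => scalerDl _ _ _)) _.
by rewrite big_split /=; congr (_ + _); apply: sum_terms_single.
Qed.

(** Besides the reduction, this records the quotients and a bound [W] on the star weights of the
    terms used; the induction of [row_span_mod] rests on that bound. *)
Definition reducible (B k W : nat) h : Prop :=
  exists r (x : 'X_{1..n.+1} -> KC J),
    [/\ is_Vreduction k h r, h = \sum_(b <- terms k) x b *: gpoly J b + r
      & forall b, b \in terms k -> x b != 0 -> (star_weight J B b < W)%N].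

Lemma reducible_step B k W h b : b \in terms k -> (star_weight J B b < W)%N ->
  reducible B k W (h - h@_b *: gpoly J b) -> reducible B k W h.
Proof.
(* A zero coefficient allows no reduction step, but then the subtraction leaves [h] unchanged. *)
move=> bk bW; have [->|hb] := eqVneq h@_b 0; first by rewrite scale0r subr0.
case=> r [x [[red rN] E xW]].
exists r, (fun c => x c + (if c == b then h@_b else 0)); split.
- split=> //; move: bk; rewrite mem_terms => /andP[/eqP bk bJ].
  exact: Vreduces_step red.
- by rewrite sum_terms_update // addrAC -E subrK.
- by move=> c ck; case: (c =P b) => [->//|_]; rewrite addr0; apply: xW.
Qed.

Hypotheses (J_monomial : monomial_ideal J) (J_stable : strongly_stable J).

(** Outer induction on [W], inner induction on the list of terms of weight exactly [W] still to be
    cleared. Clearing one creates terms of J of smaller weight only, so the list shrinks. *)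
Lemma reducible_lt B k W h : (k < B)%N ->
    (forall c, h@_c != 0 -> mdeg c = k) ->
    (forall c, h@_c != 0 -> 'X_[c] \in J -> (star_weight J B c < W)%N) ->
  reducible B k W h.
Proof.
move=> kB; elim: W h => [|W IH] h hk hW.
  exists h, (fun=> 0); split=> //; last by move=> b _; rewrite eqxx.
    split; first exact: Vreduces_refl.
    by move=> c; rewrite mcoeff_msupp => /hW cW; apply/negP => /cW.
  by rewrite big1 ?add0r // => b _; rewrite scale0r.
pose s := [seq b <- msupp h | ('X_[b] \in J) && (star_weight J B b == W)].
have sP b : b \in s -> (b \in terms k) && (star_weight J B b == W).
  by rewrite mem_filter mcoeff_msupp mem_terms => /andP[/andP[-> ->] /hk->]; rewrite eqxx.
have hs c : h@_c != 0 -> 'X_[c] \in J -> (star_weight J B c < W)%N || (c \in s).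
  move=> hc cJ; have := hW c hc cJ; rewrite ltnS leq_eqVlt orbC.
  by rewrite mem_filter mcoeff_msupp hc cJ andbT.
(* From here [s] is any list of terms of weight [W] containing all those in [h]; as [h] changes, its
   entries may drop out of the support. *)
clear hW; move: (s) sP hs => {}s sP hs; elim: s h hk sP hs => [|b s IHs] h hk sP hs.
  have [|r [x [red E xW]]] := IH h hk; first by move=> c hc /(hs c hc)/orP[].
  by exists r, x; split=> // b bk /(xW _ bk)/leqW.
have /andP[bk /eqP bW] := sP _ (mem_head _ _).
apply: (reducible_step bk); first by rewrite bW.
move: (bk); rewrite mem_terms => /andP[/eqP mb bJ].
have tail c : (gpoly J b)@_c != 0 -> c != b ->
    mdeg c = k /\ ('X_[c] \in J -> star_weight J B c < W)%N.
  by move=> bc cb; rewrite -bW -mb; apply: mcoeff_gpoly_tail; rewrite ?mb.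
have cases c : (h - h@_b *: gpoly J b)@_c != 0 ->
    c != b /\ (h@_c != 0 \/ (gpoly J b)@_c != 0).
  rewrite mcoeffB mcoeffZ => nz; split.
    by apply: contraNneq nz => ->; rewrite mcoeff_gpoly_head // mulr1 subrr.
  have [h0|] := eqVneq h@_c 0; last by left.
  right; apply: contraNneq nz => ->; by rewrite h0 mulr0 subrr.
apply: IHs => [c /cases[cb []]|c cs|c /cases[cb []]].
- exact: hk.
- by move=> /tail/(_ cb)[].
- by apply: sP; rewrite inE cs orbT.
- by move=> hc cJ; have := hs c hc cJ; rewrite inE (negbTE cb).
- by move=> /tail/(_ cb)[_ h'] /h' ->.
Qed.

Definition span_mod_frakR' (k : nat) p : Prop :=
  exists (x : 'X_{1..n.+1} -> KC J) r,
    p = \sum_(b <- terms k) x b *: gpoly J b + r /\ forall c, frakR' J r@_c.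

Lemma span_mod_small k p : (forall c, frakR' J p@_c) -> span_mod_frakR' k p.
Proof.
by exists (fun=> 0), p; split=> //; rewrite big1 ?add0r // => b _; rewrite scale0r.
Qed.

Lemma span_modD k p q :
  span_mod_frakR' k p -> span_mod_frakR' k q -> span_mod_frakR' k (p + q).
Proof.
case=> x [r [-> rR]] [y [t [-> tR]]]; exists (fun b => x b + y b), (r + t); split.
  under [in RHS]eq_bigr do rewrite scalerDl.
  by rewrite big_split /= addrACA.
by move=> c; rewrite mcoeffD; apply: ideal_genD; [apply: rR | apply: tR].
Qed.

Lemma span_modZ k z p : span_mod_frakR' k p -> span_mod_frakR' k (z *: p).
Proof.
case=> x [r [-> rR]]; exists (fun b => z * x b), (z *: r); split.
  rewrite [LHS]scalerDr; congr (_ + _); rewrite [LHS]scaler_sumr.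
  by apply: eq_bigr => b _; rewrite [LHS]scalerA.
by move=> c; rewrite mcoeffZ; apply: ideal_genM; apply: rR.
Qed.

Lemma span_mod_gpoly k b : b \in terms k -> span_mod_frakR' k (gpoly J b).
Proof.
move=> bk; exists (fun c => if c == b then 1 else 0), 0; split.
  by rewrite sum_terms_single // scale1r addr0.
by move=> c; rewrite mcoeff0; apply: ideal_gen0.
Qed.

(** The two heads cancel. By [star_weight_out], the terms of J in the tail of either product weigh
    less than its cofactor, and the cofactor of [a] weighs less than that of [a'], since [a'] is not
    the star head of the lcm. *)
Lemma Spoly_reducible B a a' : (mdeg (mlcm a a') < B)%N ->
    a \in min_gens J -> a' \in min_gens J -> a != a' ->
    star_head J (mlcm a a') = a ->
  reducible B (mdeg (mlcm a a')) (lex_weight B (mlcm a a' - a')%MM)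
    (Spoly J a a').
Proof.
move=> lB aB a'B neq hd; set l := mlcm a a' in lB hd *.
have al : (l - a + a)%MM = l by rewrite submK ?lem_mlcml.
have a'l : (l - a' + a')%MM = l by rewrite submK ?lem_mlcmr.
have lt : (star_weight J B l < lex_weight B (l - a')%MM)%N.
  rewrite -{1}a'l; apply: star_weight_gen => //; rewrite a'l ?hd //.
  by rewrite eq_sym.
have SE : Spoly J a a' = 'X_[(l - a)%MM] * Fpoly J a - 'X_[(l - a')%MM] * Fpoly J a'.
  by rewrite /Spoly /cofactorF [mlcm a' a]mlcmC.
have cases c : (Spoly J a a')@_c != 0 -> mdeg c = mdeg l /\
    ('X_[c] \in J -> (star_weight J B c < lex_weight B (l - a')%MM)%N).
  rewrite SE mcoeffB => nz; have cl : c != l.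
    apply: contraNneq nz => cl; rewrite subr_eq0; apply/eqP.
    have E1 := mcoeff_row_head (l - a)%MM (min_gens_in aB).
    have E2 := mcoeff_row_head (l - a')%MM (min_gens_in a'B).
    rewrite al in E1; rewrite a'l in E2.
    by rewrite cl; apply: etrans E1 (esym E2).
  have nzP (u v : KC J) : u - v != 0 -> u != 0 \/ v != 0.
    by have [->|] := eqVneq u 0; [rewrite sub0r oppr_eq0; right | left].
  case: (nzP _ _ nz) => {nz nzP SE} /mcoeff_row_tail;
      rewrite ?al ?a'l => /(_ cl)[g [E mg gJ]].
    have mE : mdeg c = mdeg l by rewrite E mdegD mg -mdegD al.
    split; [exact: mE | move=> cJ; apply: ltn_trans lt].
    by rewrite /star_weight hd E; apply: star_weight_out; rewrite -?E ?mE.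
  have mE : mdeg c = mdeg l by rewrite E mdegD mg -mdegD a'l.
  split; [exact: mE | move=> cJ].
  by rewrite E; apply: star_weight_out; rewrite -?E ?mE.
by apply: reducible_lt lB (fun c nz => (cases c nz).1) (fun c nz => (cases c nz).2).
Qed.

Lemma inV_cofactor a a' : a \in min_gens J ->
    star_head J (mlcm a a') = a ->
  inV (mdeg (mlcm a a')) (cofactorF J a a').
Proof.
move=> aB hd; have lJ := monomial_ideal_up J_monomial (min_gens_in aB) (lem_mlcml a a').
exists (mlcm a a'); split=> //.
by have [_ _ _ ->] := star_headP J_monomial J_stable lJ; rewrite hd.
Qed.

Lemma row_span_mod k d a : a \in min_gens J -> mdeg (d + a)%MM = k ->
  span_mod_frakR' k ('X_[d] * Fpoly J a).
Proof.
have [w] := ubnP (lex_weight k.+1 d); elim: w d a => // w IH d a dw aB mk.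
set b := (d + a)%MM in mk *.
have bJ : 'X_[b] \in J.
  by apply: monomial_ideal_up (min_gens_in aB) (lem_addl _ _).
have bk : b \in terms k by rewrite mem_terms mk eqxx.
have [hB hb sep gE] := star_headP J_monomial J_stable bJ.
set h := star_head J b in hB hb sep gE *.
have [ah|ha] := eqVneq h a.
  by have := span_mod_gpoly bk; rewrite gE ah /b addmK.
set l := mlcm h a; have lb : (l <= b)%MM by rewrite lem_mlcm hb lem_addl.
have hl : (l - h + h)%MM = l by rewrite submK ?lem_mlcml.
(* The cofactor [l / h] divides [b / h], so it inherits the separation from [h]. *)
have hd : star_head J l = h.
  rewrite -hl; apply: (star_head_separated J_monomial J_stable hB).
  move=> i j hi; apply: sep; apply: leq_trans hi _.
  by rewrite !mnmBE leq_sub2r //; apply: mnm_lepP.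
set e := (b - l)%MM.
have dE : d = (e + (l - a))%MM.
  apply: (@addIm _ a).
  by rewrite -addmA submK ?lem_mlcmr // /e submK.
have bhE : (b - h = e + (l - h))%MM.
  apply: (@addIm _ h).
  by rewrite -addmA hl !submK.
have lk : (mdeg l < k.+1)%N by rewrite ltnS -mk -(submK lb) mdegD leq_addl.
have [r [x [red SE xW]]] := Spoly_reducible lk hB aB ha hd.
(* With [e = b / l], both factorizations of [b] are [x^e] times those of the lcm [l], so the two
   rows differ by a multiple of one S-polynomial. *)
have -> : 'X_[d] * Fpoly J a = gpoly J b - 'X_[e] * Spoly J h a.
  rewrite gE bhE dE /Spoly /cofactorF [mlcm a h]mlcmC -/l !mpolyXD.
  exact: mul_sub_cancel.
rewrite -scaleN1r.
apply: span_modD; first exact: span_mod_gpoly.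
apply: span_modZ; rewrite SE mulrDr; apply: span_modD; last first.
  apply: span_mod_small => c; rewrite mcoeffXM; case: ifP => _; last exact: ideal_gen0.
  apply: ideal_gen_mem; exists h, a, r, (c - e)%MM; split=> //.
  exact: inV_cofactor.
rewrite mulr_sumr big_seq; apply: (big_ind (span_mod_frakR' k)) => [||c cl].
- by apply: span_mod_small => c; rewrite mcoeff0; apply: ideal_gen0.
- exact: span_modD.
rewrite -scalerAr; have [->|xc] := eqVneq (x c) 0.
  by rewrite scale0r; apply: span_mod_small => c'; rewrite mcoeff0; apply: ideal_gen0.
apply: span_modZ; move: (cl); rewrite mem_terms => /andP[/eqP mc cJ].
have [cB hc _ ->] := star_headP J_monomial J_stable cJ.
(* The product [x^e g_c] is again a row. By the weight bound on the quotients, its cofactor weighs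
   less than [e + (l - a) = d], so the induction applies. *)
rewrite mulrA -mpolyXD; apply: IH => //; last first.
  by rewrite -addmA submK // mdegD mc -mdegD /e submK.
apply: leq_trans (ltnSE dw); rewrite [in leqRHS]dE !lex_weightD ltn_add2l.
exact: xW.
Qed.

End Reduction.

Arguments terms {K n} J k.

(** * The two inclusions *)

Section Ideals.
Context {K : fieldType} {n : nat} {J : {pred {mpoly K[n.+1]}}}.
Hypotheses (J_monomial : monomial_ideal J) (J_stable : strongly_stable J).
Implicit Types (a b c d e g m : 'X_{1..n.+1}) (p h r : {mpoly (KC J)[n.+1]}).

Definition term_of k (l : 'I_(size (terms J k))) : 'X_{1..n.+1} :=
  nth 0%MM (terms J k) l.

Lemma term_of_in k (l : 'I_(size (terms J k))) :
  term_of l \in terms J k.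
Proof. exact: mem_nth. Qed.

Lemma term_of_eq k (l l' : 'I_(size (terms J k))) :
  (term_of l == term_of l') = (l == l').
Proof. by rewrite /term_of nth_uniq ?terms_uniq. Qed.

Lemma mcoeff_sum_terms k (x : 'X_{1..n.+1} -> KC J) p c :
  (\sum_(b <- terms J k) x b *: gpoly J b + p)@_c =
  \sum_l x (@term_of k l) * (gpoly J (term_of l))@_c + p@_c.
Proof.
rewrite mcoeffD raddf_sum (big_nth 0%MM) big_mkord; congr (_ + _).
by apply: eq_bigr => l _; rewrite [LHS]mcoeffZ.
Qed.

(** By [row_span_mod], the submatrix is congruent modulo R' to a product whose inner dimension is
    the number of terms of J of degree [k], one less than its order; such a product has determinant
    0. *)
Lemma frakA_sub_frakR' (x : KC J) : frakA J x -> frakR' J x.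
Proof.
rewrite /frakA /frakR'; apply: ideal_gen_le => y [k].
rewrite dim_homog_part => -[f [g [_ _ ->]]].
pose col j := val (val (enum_val (g j))).
have /fin_all_exists[u uP] i : exists u : 'X_{1..n.+1} -> KC J, forall j,
    frakR' J (Amx J k (f i) (g j) -
              \sum_l u (@term_of k l) * (gpoly J (term_of l))@_(col j)).
  have /andP[aB /eqP mk] := valP (enum_val (f i)); rewrite -mdegD in mk.
  have [u [r [E rR]]] := row_span_mod J_monomial J_stable aB mk.
  exists u => j; rewrite mxE /Aentry E mcoeff_sum_terms.
  by rewrite addrC addKr; apply: rR.
pose P := \matrix_(i, l) u i (@term_of k l).
pose Q := \matrix_(l, j) (gpoly J (@term_of k l))@_(col j).
rewrite -[\det _]subr0 -(det_mulmx_low P Q); apply: det_ideal_gen => i j.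
rewrite mxE [(P *m Q) i j]mxE (eq_bigr (fun l => u i (@term_of k l) *
  (gpoly J (term_of l))@_(col j))); first exact: uP.
by move=> l _; rewrite !mxE.
Qed.

Lemma row_of k d a : a \in min_gens J -> mdeg (d + a)%MM = k ->
  exists i, forall j,
    Amx J k i j = ('X_[d] * Fpoly J a)@_(val (val (enum_val j))).
Proof.
move=> aB mk.
have da : (mdeg d < k.+1)%N by rewrite ltnS -mk mdegD leq_addr.
have ak : (mdeg a < k.+1)%N by rewrite ltnS -mk mdegD leq_addl.
have ok : (a \in min_gens J) && (mdeg d + mdeg a == k)%N by rewrite aB -mdegD mk eqxx.
pose ri : row_index J k := exist _ (BMultinom da, BMultinom ak) ok.
by exists (enum_rank ri) => j; rewrite mxE enum_rankK.
Qed.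

Lemma col_of k c : mdeg c = k ->
  exists j : 'I_#|@col_index n k|, val (val (enum_val j)) = c.
Proof.
move=> mc; have ck : (mdeg c < k.+1)%N by rewrite mc.
have ok : mdeg (BMultinom ck) == k by rewrite mc.
pose ci : @col_index n k := exist _ (BMultinom ck) ok.
by exists (enum_rank ci); rewrite enum_rankK.
Qed.

Lemma Vreduces_span k h r : Vreduces k h r ->
  exists x : 'X_{1..n.+1} -> KC J, h = \sum_(b <- terms J k) x b *: gpoly J b + r.
Proof.
elim=> [{}h|{}h h' b bJ bk _ _ [x E]].
  by exists (fun=> 0); rewrite big1 ?add0r // => b _; rewrite scale0r.
have bt : b \in terms J k by rewrite mem_terms bk eqxx.
exists (fun c => x c + (if c == b then h@_b else 0)).
by rewrite sum_terms_update // addrAC -E subrK.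
Qed.

(** Row [l] of the inverse holds the quotients in the reduction of the bare term [term_of l], whose
    remainder has no coefficient in the columns of J. *)
Lemma gpoly_left_inverse k :
  exists P : 'M[KC J]_(size (terms J k)),
    P *m \matrix_(l, l') (gpoly J (@term_of k l))@_(term_of l') = 1%:M.
Proof.
have /fin_all_exists[u uP] (l : 'I_(size (terms J k))) :
    exists u : 'X_{1..n.+1} -> KC J, forall l',
    \sum_i u (@term_of k i) * (gpoly J (term_of i))@_(term_of l') = (l == l')%:R.
  have := term_of_in l; rewrite mem_terms => /andP[/eqP mb bJ].
  have Xb c : ('X_[term_of l] : {mpoly (KC J)[n.+1]})@_c != 0 -> c = term_of l.
    by rewrite mcoeffX; case: (term_of l =P c) => [->//|_]; rewrite eqxx.
  (* Base [k.+1] exceeds every exponent in degree [k]; the successor of the weight serves because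
     the bound is strict. *)
  have [||r [u [[_ rN] E _]]] := @reducible_lt _ _ _ J_monomial J_stable k.+1 k
      (star_weight J k.+1 (term_of l)).+1 'X_[term_of l] (ltnSn k).
  - by move=> c /Xb->.
  - by move=> c /Xb->.
  exists u => l'; have /(congr1 (mcoeff (term_of l'))) := E.
  rewrite mcoeff_sum_terms mcoeffX term_of_eq => ->.
  suff -> : r@_(term_of l') = 0 by rewrite addr0.
  apply: memN_msupp_eq0; apply/negP => /rN.
  by have := term_of_in l'; rewrite mem_terms => /andP[_ ->].
exists (\matrix_(l, i) u l (term_of i)); apply/matrixP => l l'.
by rewrite !mxE -uP; apply: eq_bigr => i _; rewrite !mxE.
Qed.

(** The invertible block is bordered by the row of [x^d F_a] and the column of [c]. As [r] vanishes
    on the columns of J, the coefficients [x] reproduce the bordering row there, and at [c] they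
    miss the entry by exactly [r@_c]; so [bordered_det] applies. *)
Lemma frakA_remainder k d a r (x : 'X_{1..n.+1} -> KC J) c :
    a \in min_gens J -> mdeg (d + a)%MM = k ->
    'X_[d] * Fpoly J a = \sum_(b <- terms J k) x b *: gpoly J b - r ->
    {in msupp r, forall e, 'X_[e] \notin J} -> mdeg c = k ->
  frakA J r@_c.
Proof.
move=> aB mk E rN mc; have [P PT] := gpoly_left_inverse k.
have [i0 i0P] := row_of aB mk; have [j0 j0P] := col_of mc.
have /fin_all_exists[fr frP] (l : 'I_(size (terms J k))) : exists i,
    forall j, Amx J k i j = (gpoly J (term_of l))@_(val (val (enum_val j))).
  have := term_of_in l; rewrite mem_terms => /andP[/eqP mb bJ].
  have [hB hb _ ->] := star_headP J_monomial J_stable bJ.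
  by apply: row_of => //; rewrite submK.
have /fin_all_exists[gc gcP] (l : 'I_(size (terms J k))) :
    exists j : 'I_#|@col_index n k|, val (val (enum_val j)) = term_of l.
  by apply: col_of; have := term_of_in l; rewrite mem_terms => /andP[/eqP].
set A := Amx J k in i0P frP.
have [w ->] : exists w,
    r@_c = w * \det (mxsub (ord_border i0 fr) (ord_border j0 gc) A).
  have AT : mxsub fr gc A =
      \matrix_(l, l') (gpoly J (@term_of k l))@_(term_of l').
    by apply/matrixP => l l'; rewrite mxE frP gcP mxE.
  rewrite mxsub_border AT.
  apply: (@bordered_det _ _ _ _ _ (\row_l x (term_of l)) _ _ P PT).
    apply/rowP => l; rewrite mxE [RHS]mxE i0P gcP E mcoeff_sum_terms.
    rewrite mcoeffN (_ : r@_(term_of l) = 0); last first.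
      apply: memN_msupp_eq0; apply/negP => /rN.
      by have := term_of_in l; rewrite mem_terms => /andP[_ ->].
    by rewrite oppr0 addr0; apply: eq_bigr => i _; rewrite !mxE.
  rewrite i0P j0P E mcoeff_sum_terms mcoeffN subrK mxE.
  by apply: eq_bigr => l _; rewrite mxE [X in _ * X]mxE frP j0P.
apply: ideal_genM; apply: ideal_gen_le (det_mxsub_minors A _ _) => y yA.
by apply: ideal_gen_mem; exists k; rewrite dim_homog_part.
Qed.

Lemma frakR'_sub_frakA (x : KC J) : frakR' J x -> frakA J x.
Proof.
apply: ideal_gen_le => _ [a [a' [r [c [aB a'B [b [bJ bk E]] [red rN] ->]]]]].
set l := mlcm a a' in bk red.
have [x' Ex] := Vreduces_span red.
have bt : b \in terms J (mdeg l) by rewrite mem_terms bk eqxx.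
have a'l : (l - a' + a')%MM = l by rewrite submK ?lem_mlcmr.
(* The first product of the S-polynomial is [gpoly J b]; solving for the second negates the
   quotients and adds 1 at [b]. *)
have Er : 'X_[(l - a')%MM] * Fpoly J a' =
    \sum_(e <- terms J (mdeg l)) (- x' e + if e == b then 1 else 0) *:
      gpoly J e - r.
  rewrite [X in X - r](sum_terms_update _ _ bt) scale1r -E.
  under eq_bigr do rewrite scaleNr.
  rewrite sumrN; apply: sub_eq_solve; rewrite -Ex /Spoly.
  by rewrite {3}/cofactorF mlcmC.
(* Outside degree [mdeg l] there is no column for [c], but there all rows, hence also [r], have
   coefficient 0. *)
have [mc|mc] := eqVneq (mdeg c) (mdeg l).
  by apply: frakA_remainder a'B _ Er rN mc; rewrite a'l.
have row0 d e : mdeg (d + e)%MM = mdeg l -> ('X_[d] * Fpoly J e)@_c = 0.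
  by move=> ml; apply: contra_neq_eq mc => /mdeg_row; rewrite ml.
have := congr1 (mcoeff c) Er; rewrite row0 ?a'l // mcoeff_sum_terms big1.
  by rewrite add0r mcoeffN => /esym/eqP; rewrite oppr_eq0 => /eqP->; apply: ideal_gen0.
move=> i _; have := term_of_in i; rewrite mem_terms => /andP[/eqP mi iJ].
have [_ hi _ ->] := star_headP J_monomial J_stable iJ.
by rewrite row0 ?mulr0 // submK.
Qed.

End Ideals.

Theorem lemma4p2 (K : fieldType) (n : nat) (J : {pred {mpoly K[n.+1]}})
    (J_monomial : monomial_ideal J) (J_stable : strongly_stable J) :
  forall x : KC J, frakA J x <-> frakR' J x.
Proof.
by move=> x; split; [apply: frakA_sub_frakR' | apply: frakR'_sub_frakA].
Qed.
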